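(* Let $U=\mathrm{Spec}(A)$ be a smooth affine variety over $\mathbb{C}$ of dimension $d>0$ such that $\Omega_U$ is trivial, generated by $dx_1,\ldots,dx_d$ with $x_1,\ldots,x_d\in A$. Let $n\geq 2$ be an integer and $R_n=A[t]/(t^n)$. Let $\mathrm{Der}_0(R_n)$ be the vector space of $\mathbb{C}$-derivations $D$ of $R_n$ such that $D(R_n)\subset(t)$ and $D((t))\subset(t^2)$, and let $\mathcal{G}_n^0(U)$ be the group of automorphisms $\gamma$ of the $\mathbb{C}$-algebra $R_n$ inducing the identity on $R_n/(t)=A$ and such that $\gamma(t)=(1+t\epsilon)t$ for some $\epsilon\in R_n$. For $D\in\mathrm{Der}_0(R_n)$ let $$\chi_D=\sum_{k\geq 0}\frac{1}{k!}D^k:R_n\to R_n .$$ Then the map $\mathrm{Der}_0(R_n)\to\mathcal{G}_n^0(U)$, $D\mapsto\chi_D$, is a bijection.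
   Context: $D^k$ denotes the $k$-fold composition of $D$. For $D\in\mathrm{Der}_0(R_n)$ one has $D^k(R_n)\subset(t^k)$, hence $D^k=0$ for $k\geq n$, so the sum defining $\chi_D$ is finite. *)

(* Defs.v *)
From HB Require Import structures.
From mathcomp Require Import all_boot all_order all_algebra.
From mathcomp Require Import boolp classical_sets functions fsbigop reals.
From mathcomp Require Export complex.

Set Implicit Arguments.
Unset Strict Implicit.
Unset Printing Implicit Defensive.

Import GRing.Theory.
Local Open Scope ring_scope.
Local Open Scope classical_set_scope.

Section Algebras.
Variables (k : fieldType) (A : comAlgType k).

(* An A-module M is a k-module through c |-> c%:A. *)
Definition is_derivation (M : lmodType A) (delta : A -> M) : Prop :=
  [/\ forall a b, delta (a + b) = delta a + delta b,
      forall (c : k) a, delta (c *: a) = (c%:A : A) *: delta a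
    & forall a b, delta (a * b) = a *: delta b + b *: delta a].

(* Universal property characterizing (Omega_{A/k}, d). *)
Definition is_kaehler_differentials (Omega : lmodType A) (d : A -> Omega) : Prop :=
  is_derivation d /\
  forall (M : lmodType A) (delta : A -> M), is_derivation delta ->
    exists f : {linear Omega -> M}, (forall a, f (d a) = delta a) /\
      forall g : {linear Omega -> M}, (forall a, g (d a) = delta a) -> g =1 f.

Definition is_free_basis (M : lmodType A) m (e : 'I_m -> M) : Prop :=
  (forall w : M, exists c : 'I_m -> A, w = \sum_(i < m) c i *: e i) /\
  (forall c : 'I_m -> A, \sum_(i < m) c i *: e i = 0 -> forall i, c i = 0).

Definition finite_type : Prop :=
  exists s : seq A, forall S : {pred A},
    subalg_closed S -> {subset s <= S} -> forall a, a \in S.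

(* Infinitesimal lifting criterion along square-zero extensions (EGA IV);
   over a field, smooth means formally smooth and locally of finite type. *)
Definition formally_smooth : Prop :=
  forall (B B' : comAlgType k) (p : {lrmorphism B -> B'}),
    (forall y, exists x, p x = y) ->
    (forall x y, p x = 0 -> p y = 0 -> x * y = 0) ->
  forall f : {lrmorphism A -> B'},
  exists g : {lrmorphism A -> B}, forall a, p (g a) = f a.

Definition is_prime_ideal (P : {pred A}) : Prop :=
  idealr_closed P /\ prime_idealr_closed P.

Definition has_prime_chain (m : nat) : Prop :=
  exists P : nat -> {pred A},
    (forall i, (i <= m)%N -> is_prime_ideal (P i)) /\
    (forall i, (i < m)%N -> {subset P i <= P i.+1} /\
                            exists2 a, a \in P i.+1 & a \notin P i).

Definition krull_dim (m : nat) : Prop :=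
  has_prime_chain m /\ ~ has_prime_chain m.+1.

(* Spec A is a smooth affine (integral) variety over k of dimension m. *)
Definition smooth_affine_variety (m : nat) : Prop :=
  [/\ GRing.integral_domain_axiom A, finite_type, formally_smooth
    & krull_dim m].

End Algebras.

(* A[t]/(t^n); the quotient {poly %/ p} is the expected one because 'X^n is
   monic and nonconstant for n > 0. *)
Definition truncpoly (k : fieldType) (A : comAlgType k) (n : nat) : Type :=
  {poly %/ ('X^n : {poly A})}.

HB.instance Definition _ (k : fieldType) (A : comAlgType k) n :=
  GRing.ComNzRing.on (@truncpoly k A n).

Section TruncAlg.
Variables (k : fieldType) (A : comAlgType k) (n : nat).
Local Notation Rn := (truncpoly A n).

(* Restriction of scalars along k -> A. *)
Definition tp_scale (c : k) (r : Rn) : Rn :=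
  (c%:A : A) *: (r : {poly %/ ('X^n : {poly A})}).

Fact tp_scaleA c c' r : tp_scale c (tp_scale c' r) = tp_scale (c * c') r.
Proof. by rewrite /tp_scale scalerA mulr_algl scalerA. Qed.

Fact tp_scale1 : left_id 1 tp_scale.
Proof. by move=> r; rewrite /tp_scale !scale1r. Qed.

Fact tp_scaleDr : right_distributive tp_scale +%R.
Proof. by move=> c r s; rewrite /tp_scale scalerDr. Qed.

Fact tp_scaleDl r : {morph tp_scale^~ r : c c' / c + c'}.
Proof. by move=> c c'; rewrite /tp_scale !scalerDl. Qed.

HB.instance Definition _ := GRing.Zmodule_isLmodule.Build k Rn
  tp_scaleA tp_scale1 tp_scaleDr tp_scaleDl.

Fact tp_scaleAl (c : k) (r s : Rn) : c *: (r * s) = (c *: r) * s.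
Proof. exact: (@scalerAl A {poly %/ ('X^n : {poly A})} c%:A r s). Qed.

HB.instance Definition _ := GRing.Lmodule_isLalgebra.Build k Rn tp_scaleAl.

Fact tp_scaleAr (c : k) (r s : Rn) : c *: (r * s) = r * (c *: s).
Proof. exact: (@scalerAr A {poly %/ ('X^n : {poly A})} c%:A r s). Qed.

HB.instance Definition _ := GRing.Lalgebra_isAlgebra.Build k Rn tp_scaleAr.

End TruncAlg.

Section DerAut.
Variables (k : fieldType) (A : comAlgType k) (n : nat).
Local Notation Rn := (truncpoly A n).

Definition tvar : Rn := qpolyX ('X^n : {poly A}).

Definition principal_ideal (B : comNzRingType) (b : B) : set B :=
  [set r | exists s, r = b * s].

Definition Der0 : set (Rn -> Rn) :=
  [set D | [/\ @is_derivation k Rn Rn^o D,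
               forall r, principal_ideal tvar (D r)
             & forall r, principal_ideal tvar r ->
                         principal_ideal (tvar ^+ 2) (D r)]].

(* Since gamma t lies in (t), inducing the identity on Rn/(t) means that
   gamma r and r agree modulo (t). *)
Definition Aut0 : set (Rn -> Rn) :=
  [set gamma | [/\ linear gamma /\ monoid_morphism gamma, bijective gamma,
                   forall r, principal_ideal tvar (gamma r - r)
                 & exists eps : Rn, gamma tvar = (1 + tvar * eps) * tvar]].

(* The sum ranges over all natural numbers; it is meaningful because only
   finitely many terms are nonzero when D is in Der0. *)
Definition chi (D : Rn -> Rn) : Rn -> Rn :=
  fun r => \sum_(m \in [set: nat]) (((m`!)%:R : k)^-1 *: iter m D r).

End DerAut.

Arguments tvar {k} A n.
Arguments Der0 {k} A n _.
Arguments Aut0 {k} A n _.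

(* Main.v *)
(* The only features of R_n = A[t]/(t^n) that matter are that it is a
   commutative algebra over a field of characteristic 0 and that t^n = 0.  An
   element D of Der_0 sends (t^j) into (t^(j+1)), so exp(sD) is a finite sum; the
   Leibniz rule makes it an algebra endomorphism, and exp(sD) exp(uD) =
   exp((s+u)D) makes it bijective.

   Both the inverse and injectivity come from interpolation: a polynomial
   with coefficients in a Q-algebra is determined by its values at the natural
   numbers.  If g is in Aut_0, then N = g - 1 also sends (t^j) into (t^(j+1)), so
   g^m r = sum_i 'C(m, i) N^i r is a polynomial P_r(m) in m.  Let D r be its
   coefficient of degree 1, i.e. D = log g.  Comparing coefficients in
   P_(ab) = P_a P_b shows that D is a derivation, and P_r' = D P_r, which follows
   from g^(m+l) = g^m g^l, gives P_r(m) = exp(mD) r, hence g = exp(D).  For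
   injectivity, D is recovered from exp(D) as the degree 1 coefficient of
   m |-> exp(D)^m = exp(mD). *)
From HB Require Import structures.
Require Import Defs.
From mathcomp Require Import all_boot all_order all_algebra.
From mathcomp Require Import boolp classical_sets functions fsbigop reals.
From mathcomp Require Import ring.

Local Open Scope ring_scope.
Local Open Scope classical_set_scope.
Import GRing.Theory.

(** Groups a product of two truncated series by total degree [l = i + j]; nilpotency kills the part
    of the square beyond the triangle. *)
Lemma sum_triangle (V : nmodType) (F : nat -> nat -> V) n :
    (forall i j, (n <= i + j)%N -> F i j = 0) ->
  \sum_(l < n) \sum_(i < l.+1) F i (l - i)%N = \sum_(i < n) \sum_(j < n) F i j.
Proof.
move=> F0.
transitivity (\sum_(l < n) \sum_(i < n | (i < l.+1)%N) F i (l - i)%N).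
  apply: eq_bigr => l _; exact: (big_ord_widen n (fun i => F i (l - i)%N)).
rewrite (exchange_big_dep predT)//=; apply: eq_bigr => i _.
rewrite -(big_mkord (fun l => i < l.+1)%N (fun l => F i (l - i)%N)).
rewrite (@big_cat_nat _ _ _ i) ?leq0n 1?ltnW//=.
rewrite big_nat_cond big_pred0 ?add0r.
  rewrite -{1}[val i]add0n big_addn.
  rewrite (eq_big predT (F i)) => [|j|j _]; last 2 first.
  - by rewrite ltnS leq_addl.
  - by rewrite addnK.
  rewrite -(big_mkord predT (F i)) [RHS](big_cat_nat (n := (n - i)%N)) ?leq_subr//=.
  rewrite [X in _ + X]big_nat_cond [X in _ + X]big1 ?addr0// => j.
  by rewrite andbT leq_subLR => /andP[ij _]; exact: F0.
by move=> j; rewrite ltnS; case: ltnP; rewrite ?andbF.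
Qed.

(** * Derivations as linear Leibniz maps *)

Section Derivations.
Variables (k : fieldType) (B : comAlgType k).

Definition leibniz (D : B -> B) := forall a b, D (a * b) = a * D b + b * D a.

Lemma is_derivationP (D : B -> B) :
  is_derivation (D : B -> B^o) <-> linear D /\ leibniz D.
Proof.
split=> [[DD DZ DM]|[Dlin DM]].
  by split=> // c a b; rewrite DD DZ /GRing.scale/= mulr_algl.
split=> //.
- by move=> a b; rewrite -[a]scale1r Dlin !scale1r.
- move=> c a; rewrite -[RHS]/(c%:A * D a) mulr_algl -[c *: a]addr0 Dlin.
  have -> : D 0 = 0; last by rewrite addr0.
  by rewrite -[X in D X](subrr (0 : B)) -scaleN1r addrC Dlin scaleN1r addNr.
Qed.

End Derivations.

Arguments leibniz {k B} D.

(** * Interpolation at the natural numbers in characteristic 0 *)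

Section CharacteristicZero.
Variables (k : fieldType) (B : comAlgType k).
Hypothesis pchar0 : [pchar k] =i pred0.

Lemma natSr_neq0 m : (m.+1)%:R != 0 :> k.
Proof. by have /pcharf0P -> := pchar0. Qed.

Lemma factr_neq0 m : (m`!)%:R != 0 :> k.
Proof. by case: (m`!) (fact_gt0 m) => // l _; exact: natSr_neq0. Qed.

Lemma bin_div_fact m i : (i <= m)%N ->
  ('C(m, i))%:R / (m`!)%:R = (i`!)%:R^-1 * ((m - i)`!)%:R^-1 :> k.
Proof.
move=> im; rewrite -(bin_fact im) !natrM -[LHS]mulr1.
have := factr_neq0 m; rewrite -(bin_fact im) !natrM !mulf_eq0 !negb_or.
by move=> /and3P[? ? ?]; field; apply/and3P.
Qed.

Lemma mulrSn_eq0 (b : B) m : b *+ m.+1 = 0 -> b = 0.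
Proof.
by move=> /eqP; rewrite -scaler_nat scaler_eq0 (negPf (natSr_neq0 m)) => /eqP.
Qed.

(** [B] may have zero divisors, so roots are divided out one at a time: the factor [m - a] left
    after evaluation is a nonzero integer, hence cancellable. *)
Lemma poly_nat_eq0 (p : {poly B}) : (forall m : nat, p.[m%:R] = 0) -> p = 0.
Proof.
(* Vanishing is only asked from [a] on, since dividing by ['X - a] loses control of the quotient at
   [a] itself. *)
suff H s a (q : {poly B}) : (size q <= s)%N ->
    (forall m, (a <= m)%N -> q.[m%:R] = 0) -> q = 0.
  by move=> p0; apply: (H (size p) 0).
elim: s a q => [|s IHs] a q; first by rewrite size_poly_leq0 => /eqP.
move=> sq q0; have /factor_theorem[r qE] : root q a%:R by apply/eqP/q0.
have [r0|rN0] := eqVneq r 0; first by rewrite qE r0 mul0r.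
suff r0 : r = 0 by rewrite qE r0 mul0r.
apply: (IHs a.+1).
  by move: sq; rewrite qE size_Mmonic ?monicXsubC// size_XsubC addn2.
move=> m am; have /eqP := q0 m (ltnW am).
rewrite qE hornerM hornerXsubC -natrB ?(ltnW am)// mulr_natr => /eqP.
by have := am; rewrite -subn_gt0; case: (m - a)%N => // l _ /mulrSn_eq0.
Qed.

Lemma eq_poly_nat (p q : {poly B}) :
  (forall m : nat, p.[m%:R] = q.[m%:R]) -> p = q.
Proof.
move=> pq; apply/eqP; rewrite -subr_eq0; apply/eqP/poly_nat_eq0 => m.
by rewrite hornerD hornerN pq subrr.
Qed.

(** The binomial coefficient X(X-1)...(X-i+1)/i! as a polynomial; the inverses are taken in [k], as
    [B] need not be a field. *)
Fixpoint binpoly i : {poly B} :=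
  if i is j.+1 then (((j.+1)%:R^-1 : k)%:A : B) *: (('X - (j%:R)%:P) * binpoly j)
  else 1.

Lemma horner_binpoly i m : (binpoly i).[m%:R] = ('C(m, i))%:R.
Proof.
elim: i => [|i IHi] /=; first by rewrite hornerC bin0.
rewrite hornerZ hornerM hornerXsubC IHi mulr_algl.
apply: (scalerI (natSr_neq0 i)).
rewrite scalerA divff ?scale1r ?natSr_neq0// scaler_nat.
have [im|mi] := leqP i m; last by rewrite !bin_small ?leqW// mulr0 mul0rn.
by rewrite -natrB// -natrM -[RHS]mulr_natl -natrM mul_bin_left.
Qed.


Lemma linear_pack (f : B -> B) :
  linear f -> exists F : {linear B -> B}, F = f :> (B -> B).
Proof.
move=> flin; pose fL := GRing.isLinear.Build k B B *:%R f flin.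
by exists (HB.pack f fL : {linear B -> B}).
Qed.

(** * The t-adic filtration *)

Section Filtration.
Variables (t : B) (n : nat).
Hypothesis tn0 : t ^+ n = 0.

Local Notation In j := (principal_ideal (t ^+ j)).

Lemma pow_ideal0 r : In 0%N r.
Proof. by exists r; rewrite mul1r. Qed.

Lemma pow_idealD j r s : In j r -> In j s -> In j (r + s).
Proof. by move=> [r' ->] [s' ->]; exists (r' + s'); rewrite mulrDr. Qed.

Lemma pow_ideal_sum j (I : Type) (u : seq I) (P : pred I) (F : I -> B) :
  (forall i, P i -> In j (F i)) -> In j (\sum_(i <- u | P i) F i).
Proof.
move=> FI; elim/big_ind: _ => //; first by exists 0; rewrite mulr0.
exact: pow_idealD.
Qed.

Lemma pow_idealMr j r s : In j r -> In j (r * s).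
Proof. by move=> [r' ->]; exists (r' * s); rewrite mulrA. Qed.

Lemma pow_idealZ j (c : k) r : In j r -> In j (c *: r).
Proof. by move=> [r' ->]; exists (c *: r'); rewrite scalerAr. Qed.

Lemma pow_idealM i j r s : In i r -> In j s -> In (i + j) (r * s).
Proof. by move=> [r' ->] [s' ->]; exists (r' * s'); rewrite exprD mulrACA. Qed.

Lemma pow_ideal_leq i j r : (i <= j)%N -> In j r -> In i r.
Proof.
move=> ij [r' ->]; exists (t ^+ (j - i) * r').
by rewrite mulrA -exprD subnKC.
Qed.

Lemma pow_ideal_eq0 j r : (n <= j)%N -> In j r -> r = 0.
Proof. by move=> nj /(pow_ideal_leq _ _ _ nj)[s ->]; rewrite tn0 mul0r. Qed.

Definition raises (f : B -> B) := forall j r, In j r -> In j.+1 (f r).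

Lemma raises_iter f : raises f -> forall m r, In m (iter m f r).
Proof.
by move=> fI; elim=> [|m IHm] r; [exact: pow_ideal0 | rewrite iterS; exact: fI].
Qed.

Lemma iter_raises_eq0 f : raises f -> forall m r, (n <= m)%N -> iter m f r = 0.
Proof. by move=> fI m r nm; apply: (pow_ideal_eq0 _ _ nm (raises_iter f fI m r)). Qed.

Lemma leibniz1 (D : B -> B) : leibniz D -> D 1 = 0.
Proof.
move=> /(_ 1 1); rewrite mulr1 !mul1r => /eqP.
by rewrite -[X in X == _]addr0 (inj_eq (addrI _)) => /eqP.
Qed.

(** The Leibniz rule reduces everything to D(t^j), where induction applies: D(t^(j+1)) = t D(t^j) +
    t^j D(t), with D(t) in (t^2). *)
Lemma leibniz_raises (D : B -> B) : leibniz D ->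
    (forall r, In 1%N (D r)) -> (forall r, In 1%N r -> In 2%N (D r)) ->
  raises D.
Proof.
move=> Dleib D1 D2 j _ [s ->].
have DtX : In j.+1 (D (t ^+ j)).
  elim: j => [|j IHj]; first exact: D1.
  rewrite [X in D X]exprS Dleib; apply: pow_idealD.
    by rewrite -[X in In X]add1n; apply: pow_idealM => //; exists 1; rewrite mulr1.
  rewrite -addn2; apply: pow_idealM; first by exists 1; rewrite mulr1.
  by apply: D2; exists 1; rewrite mulr1.
rewrite Dleib; apply: pow_idealD; last by rewrite mulrC; apply: pow_idealMr.
by rewrite -addn1; apply: pow_idealM => //; exists 1; rewrite mulr1.
Qed.

Lemma morph_sub1_raises (g : {lrmorphism B -> B}) :
    (forall r, In 1%N (g r - r)) -> (exists eps, g t = (1 + t * eps) * t) ->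
  raises (fun r => g r - r).
Proof.
move=> g1 [eps gt] j _ [s ->].
have [e eE] : exists e, (1 + t * eps) ^+ j = 1 + t * e.
  elim: (j) => [|i [e eE]]; first by exists 0; rewrite mulr0 addr0.
  by rewrite exprS eE; exists (e + eps * (1 + t * e)); ring.
(* With g(t^j) = (1 + te)t^j and g(s) - s = tu, the difference g(t^j s) - t^j s is t^j(g(s) - s) +
   t^(j+1) e g(s). *)
have [u gsE] := g1 s; exists (u + e * g s).
rewrite rmorphM rmorphXn /= gt exprMn eE exprSr.
have -> : g s = s + t * u by rewrite -[t * u]/(t ^+ 1 * u) -gsE addrC subrK.
ring.
Qed.

(** * Exponentials of nilpotent derivations *)

Lemma iter_lin_sum (D : {linear B -> B}) m (I : Type) (u : seq I)
    (c : I -> k) (F : I -> B) :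
  iter m D (\sum_(i <- u) c i *: F i) = \sum_(i <- u) c i *: iter m D (F i).
Proof.
elim: m => // m IHm; rewrite iterS IHm linear_sum.
by apply: eq_bigr => i _; rewrite linearZ.
Qed.

Lemma iter_linear (D : {linear B -> B}) m : linear (iter m D).
Proof. by move=> c a b; elim: m => // m IHm; rewrite !iterS IHm linearP. Qed.

Lemma iter_leibniz (D : {linear B -> B}) : leibniz D -> forall m a b,
  iter m D (a * b) = \sum_(i < m.+1) (iter i D a * iter (m - i) D b) *+ 'C(m, i).
Proof.
move=> Dleib m a b; elim: m => [|m IHm].
  by rewrite big_ord_recl big_ord0 addr0.
rewrite iterS IHm linear_sum.
under eq_bigr => i _ do rewrite raddfMn /= Dleib mulrnDl -!iterS
  [_ * iter i.+1 D a]mulrC.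
rewrite big_split big_ord_recl /= subn0 bin0 mulr1n.
rewrite [RHS]big_ord_recl /= bin0 mulr1n -addrA; congr (_ + _).
(* Both sums are aligned on D^(i+1) a so that Pascal's rule merges them; the added top term has
   coefficient ['C(m, m.+1)], which is 0. *)
transitivity (\sum_(i < m.+1) (iter i.+1 D a * iter (m - i) D b) *+ 'C(m, i.+1)
              + \sum_(i < m.+1) (iter i.+1 D a * iter (m - i) D b) *+ 'C(m, i)).
  congr (_ + _); rewrite [RHS]big_ord_recr /= bin_small// mulr0n addr0.
  by apply: eq_bigr => i _; rewrite -!iterS /bump add1n -subSn.
by rewrite -big_split; apply: eq_bigr => i _; rewrite /= -mulrnDr -binS /bump add1n subSS.
Qed.

(** exp(sD), cut at the nilpotency bound. The parameter s gives the inverse at -1 and the powers of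
    exp(D) at the naturals. *)
Definition expd (D : B -> B) (s : k) r :=
  \sum_(i < n) (s ^+ i / (i`!)%:R) *: iter i D r.

Lemma expd_linear (D : {linear B -> B}) s : linear (expd D s).
Proof.
move=> c a b; rewrite /expd scaler_sumr -big_split /=; apply: eq_bigr => i _.
by rewrite iter_linear scalerDr !scalerA [c * _]mulrC.
Qed.

Lemma expd0 (D : B -> B) r : (0 < n)%N -> expd D 0 r = r.
Proof.
rewrite /expd; case: n => // m _.
rewrite big_ord_recl big1 => [|i _]; last by rewrite expr0n mul0r scale0r.
by rewrite fact0 divr1 expr0 scale1r addr0.
Qed.

Lemma expdD (D : {linear B -> B}) : raises D -> forall s u r,
  expd D (s + u) r = expd D s (expd D u r).
Proof.
move=> DI s u r; rewrite /expd.
under [RHS]eq_bigr => i _.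
  rewrite iter_lin_sum scaler_sumr.
  under eq_bigr => j _ do rewrite scalerA -iterD.
  over.
rewrite /= -(@sum_triangle _ (fun i j => (s ^+ i / (i`!)%:R * (u ^+ j / (j`!)%:R))
  *: iter (i + j) D r)) => [|i j ij]; last by rewrite iter_raises_eq0// scaler0.
apply: eq_bigr => m _; rewrite [s + u]addrC exprDn mulr_suml scaler_suml.
apply: eq_bigr => i _; have im : (i <= m)%N by rewrite -ltnS.
rewrite subnKC//; congr (_ *: _).
rewrite -[_ *+ 'C(m, i)]mulr_natr -(mulrA (_ * _)).
by rewrite bin_div_fact//; ring.
Qed.

Lemma expd_nat (D : {linear B -> B}) : (0 < n)%N -> raises D -> forall m r,
  expd D m%:R r = iter m (expd D 1) r.
Proof.
move=> n0 DI; elim=> [|m IHm] r; first exact: expd0.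
by rewrite -natr1 addrC expdD// IHm.
Qed.

(** The iterated Leibniz formula turns exp(sD)(ab) into the Cauchy product; the terms D^i a D^j b
    with i + j at least n lie in (t^n) = 0. *)
Lemma expdM (D : {linear B -> B}) : leibniz D -> raises D -> forall s,
  {morph expd D s : a b / a * b}.
Proof.
move=> Dleib DI s a b; rewrite /expd mulr_suml.
under [RHS]eq_bigr => i _ do rewrite mulr_sumr.
rewrite /= -(@sum_triangle _ (fun i j => ((s ^+ i / (i`!)%:R) *: iter i D a) *
  ((s ^+ j / (j`!)%:R) *: iter j D b))) => [|i j ij]; last first.
  rewrite -scalerAl -scalerAr (@pow_ideal_eq0 (i + j) (iter i D a * _)) ?scaler0//.
  by apply: pow_idealM; apply: raises_iter.
apply: eq_bigr => m _; rewrite iter_leibniz// scaler_sumr; apply: eq_bigr => i _.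
have im : (i <= m)%N by rewrite -ltnS.
rewrite -scalerAl -scalerAr scalerA -scaler_nat scalerA; congr (_ *: _).
rewrite mulrACA -exprD subnKC// -bin_div_fact//; ring.
Qed.

Lemma expd_bij (D : {linear B -> B}) : (0 < n)%N -> raises D ->
  bijective (expd D 1).
Proof.
by move=> n0 DI; exists (expd D (- 1)) => r; rewrite -expdD// ?subrr ?addNr expd0.
Qed.

Lemma expd_one (D : {linear B -> B}) : leibniz D -> raises D -> (0 < n)%N ->
  expd D 1 1 = 1.
Proof.
move=> Dleib DI; rewrite /expd; case: n => // m _.
rewrite big_ord_recl big1 => [|i _]; last first.
  suff -> : iter (lift ord0 i) D 1 = 0 by rewrite scaler0.
  by rewrite iterSr leibniz1//; elim: (i : nat) => // l /= ->; rewrite raddf0.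
by rewrite fact0 divr1 expr0 scale1r addr0.
Qed.

Lemma expd_sub j (D : {linear B -> B}) r : raises D -> (0 < n)%N -> In j r ->
  In j.+1 (expd D 1 r - r).
Proof.
move=> DI; rewrite /expd; case: n => // m _ rI.
rewrite big_ord_recl fact0 divr1 expr0 scale1r addrAC subrr add0r.
apply: pow_ideal_sum => i _; apply: pow_idealZ; rewrite lift0.
suff H l : In (j + l.+1)%N (iter l.+1 D r).
  by apply: (pow_ideal_leq _ _ _ _ (H i)); rewrite -addSnnS leq_addr.
by elim: l => [|l IHl]; rewrite ?addn1 ?iterS ?addnS; apply: DI => //; rewrite -?addnS.
Qed.

Lemma expd_inj (D D' : {linear B -> B}) : (1 < n)%N -> raises D -> raises D' ->
  expd D 1 =1 expd D' 1 -> D =1 D'.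
Proof.
move=> n1 DI D'I DD' r; have n0 := ltnW n1.
(* Its value at m is exp(mE) r = exp(E)^m r, so exp(E) determines it; its degree 1 coefficient,
   present since n > 1, is E r. *)
pose P (E : B -> B) := \poly_(i < n) ((i`!)%:R^-1 *: iter i E r).
have PE (E : {linear B -> B}) m : raises E -> (P E).[m%:R] = iter m (expd E 1) r.
  move=> EI; rewrite -expd_nat// horner_poly; apply: eq_bigr => i _.
  by rewrite -natrX mulr_natr -scaler_nat natrX scalerA.
have : P D = P D'.
  by apply: eq_poly_nat => m; rewrite !PE//; exact: eq_iter.
move=> /(congr1 (fun p : {poly B} => p`_1)).
by rewrite !coef_poly n1 !invr1 !scale1r.
Qed.

(** * The logarithm of a unipotent automorphism *)

Section Logarithm.
Variables (g : {lrmorphism B -> B}) (N : {linear B -> B}).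
Hypotheses (n_gt1 : (1 < n)%N) (NI : raises N).
Hypothesis NE : forall r, N r = g r - r.

(* The polynomial m |-> g^m r, by Newton's formula g^m = (1 + N)^m; its
   coefficient of degree 1 is log(g) r. *)
Definition flow_poly r : {poly B} := \sum_(i < n) iter i N r *: binpoly i.

Lemma horner_flow_poly r m : (flow_poly r).[m%:R] = iter m g r.
Proof.
rewrite /flow_poly horner_sum.
under eq_bigr => i _ do rewrite hornerZ horner_binpoly mulr_natr.
elim: m r => [|m IHm] r.
  move: n_gt1; case: n => // l _; by rewrite big_ord_recl big1 ?addr0.
rewrite iterSr -IHm.
(* g = 1 + N, so the induction on m becomes Pascal's rule. *)
have gE i : iter i N (g r) = iter i N r + iter i.+1 N r.
  have -> : g r = 1 *: r + N r by rewrite NE scale1r addrC subrK.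
  by rewrite iter_linear scale1r -iterSr.
under [RHS]eq_bigr => i _ do rewrite gE mulrnDl.
have : forall i r, (n <= i)%N -> iter i N r = 0.
  by move=> i s; exact: iter_raises_eq0.
move: n_gt1; case: n => // l _ N0.
rewrite big_split big_ord_recl [X in _ = X + _]big_ord_recl /= !bin0 -addrA.
congr (_ + _); rewrite [X in _ = _ + X]big_ord_recr /= -iterS N0// mul0rn addr0.
by rewrite -big_split; apply: eq_bigr => i _; rewrite /= /bump add1n binS mulrnDr.
Qed.

Definition logd r := (flow_poly r)`_1.

Lemma flow_poly_linear (c : k) a b :
  flow_poly (c *: a + b) = (c%:A : B) *: flow_poly a + flow_poly b.
Proof.
apply: eq_poly_nat => m; rewrite hornerD hornerZ !horner_flow_poly mulr_algl.
exact: iter_linear.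
Qed.

Lemma logd_linear : linear logd.
Proof. by move=> c a b; rewrite /logd flow_poly_linear coefD coefZ mulr_algl. Qed.

(** Each g^m is multiplicative, hence so is [flow_poly]; in degree 1 the constant terms are a and b,
    the values at m = 0. *)
Lemma logd_leibniz : leibniz logd.
Proof.
move=> a b; rewrite /logd.
have -> : flow_poly (a * b) = flow_poly a * flow_poly b.
  apply: eq_poly_nat => m; rewrite hornerM !horner_flow_poly.
  by elim: m => // m /= ->; rewrite rmorphM.
have f0 r : (flow_poly r)`_0 = r.
  by rewrite -horner_coef0 -[0]/(0%:R) horner_flow_poly.
by rewrite coefM !big_ord_recl big_ord0 /= !f0 addr0 [_ * b]mulrC.
Qed.

Lemma logd_raises : raises logd.
Proof.
move=> j r rI; rewrite /logd coef_sum; move: (n_gt1); case: n => // l _.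
(* The index 0 term is constant and drops out in degree 1, leaving only positive powers of N. *)
rewrite big_ord_recl /= coefZ coefC mulr0 add0r; apply: pow_ideal_sum => i _.
rewrite coefZ; apply: pow_idealMr; rewrite add0n.
elim: (i : nat) => [|m IHm]; first exact: NI.
by rewrite -addn1 in IHm *; exact: pow_ideal_leq (NI _ _ IHm).
Qed.

(** The differential equation q' = log(g) q, read coefficientwise. *)
Lemma coefS_flow_poly r j : (flow_poly r)`_j.+1 *+ j.+1 = logd ((flow_poly r)`_j).
Proof.
have [L LE] := linear_pack logd logd_linear.
pose q := flow_poly r; rewrite -/q.
have dq l : q^`().[l%:R] = logd q.[l%:R].
  (* Translating time by l restarts the flow at g^l r, so q'(l) is the degree 1 coefficient of that
     new flow. *)
  have qE : q \Po ('X + (l%:R)%:P) = flow_poly (iter l g r).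
    apply: eq_poly_nat => m; rewrite horner_comp hornerD hornerX hornerC -natrD.
    by rewrite !horner_flow_poly iterD.
  rewrite horner_flow_poly /logd -qE -[X in _ = X]mulr1n -coef_deriv -horner_coef0.
  by rewrite deriv_comp derivD derivX derivC addr0 mulr1 horner_comp !hornerE.
rewrite -coef_deriv; have -> : q^`() = \poly_(i < size q) logd q`_i.
  apply: eq_poly_nat => l; rewrite dq horner_poly horner_coef -LE linear_sum.
  by apply: eq_bigr => i _; rewrite -natrX !mulr_natr linearMn.
rewrite coef_poly; case: ltnP => // sq.
by rewrite nth_default// -LE linear0.
Qed.

Lemma expd_logd : expd logd 1 =1 g.
Proof.
move=> r; have [L LE] := linear_pack logd logd_linear.
have LI := logd_raises.
pose q := flow_poly r.
(* Solves the recurrence from the initial value q(0) = r; evaluating at 1 then gives both g r and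
   exp(log g) r. *)
have qE j : q`_j = (j`!)%:R^-1 *: iter j logd r.
  elim: j => [|j IHj].
    by rewrite invr1 scale1r -horner_coef0 -[0]/(0%:R) horner_flow_poly.
  apply: (scalerI (natSr_neq0 j)); rewrite scaler_nat coefS_flow_poly -/q IHj.
  by rewrite -LE linearZ iterS LE scalerA factS natrM invfM mulVKf ?natSr_neq0.
have qn : (size q <= n)%N.
  by apply/leq_sizeP => j nj; rewrite qE iter_raises_eq0// scaler0.
rewrite -[g r]/(iter 1 g r) -horner_flow_poly (horner_coef_wide _ qn) /expd.
by apply: eq_bigr => j _; rewrite !expr1n mulr1 qE mul1r.
Qed.

End Logarithm.

End Filtration.

End CharacteristicZero.

Arguments raises {k B} t f.
Arguments expd {k B} n D s r.
Arguments logd {k B} n N r.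

(** * Application to the truncated polynomial algebra *)

Lemma tvarX (k : fieldType) (A : comAlgType k) n : (0 < n)%N ->
  tvar A n ^+ n = 0.
Proof.
move=> n0; suff : (in_qpoly ('X^n : {poly A}) 'X) ^+ n = 0 by [].
rewrite -rmorphXn; apply: val_inj => /=.
by rewrite mk_monic_Xn prednK// Pdiv.RingMonic.rmodpp// monicXn.
Qed.

Section TruncatedPolynomials.
Variables (k : fieldType) (A : comAlgType k) (n : nat).
Hypotheses (pchar0 : [pchar k] =i pred0) (n_gt1 : (1 < n)%N).

Local Notation Rn := (truncpoly A n).
Local Notation t := (tvar A n).

Let n_gt0 : (0 < n)%N := ltnW n_gt1.
Let tn0 : t ^+ n = 0 := tvarX k A n n_gt0.

Lemma Der0P (D : Rn -> Rn) :
  Der0 A n D <-> [/\ linear D, leibniz D & raises t D].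
Proof.
rewrite /Der0 /=; split=> [[/is_derivationP[Dlin DM] D1 D2]|[Dlin DM DI]].
  by split=> //; apply: leibniz_raises => //; rewrite expr1.
have I1 : principal_ideal (t ^+ 1) = principal_ideal t by rewrite expr1.
split; first exact/is_derivationP.
- by move=> r; rewrite -I1; apply: DI; exact: pow_ideal0.
- by move=> r; rewrite -I1; exact: DI.
Qed.

Lemma chi_expd (D : Rn -> Rn) : raises t D -> chi D =1 expd n D 1.
Proof.
move=> DI r; rewrite /chi /expd.
rewrite (fsbig_ord _ n (fun i => (1 ^+ i / (i`!)%:R) *: iter i D r)).
rewrite (@fsbig_widen _ _ _ _ `I_n setT)//= => [|i].
  by apply: eq_fsbigr => i _; rewrite expr1n mul1r.
(* The terms of index at least n vanish, so the sum over all naturals has finite support and is not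
   the default 0. *)
move=> [_ /negP]; rewrite -leqNgt => ni.
by rewrite /= (iter_raises_eq0 _ _ _ _ tn0)// scaler0.
Qed.

Lemma chi_Aut0 (D : Rn -> Rn) : Der0 A n D -> Aut0 A n (chi D).
Proof.
move=> /Der0P[Dlin DM DI].
have -> : chi D = expd n D 1 by apply/funext; exact: chi_expd.
have [L LE] := linear_pack _ _ _ Dlin; subst D.
split.
- split; first exact: expd_linear.
  by split; [exact: expd_one DI n_gt0 | exact: expdM tn0 _ DM DI _].
- exact: expd_bij tn0 _ n_gt0 DI.
- by move=> r; rewrite -[X in principal_ideal X]expr1; apply: expd_sub;
    last exact: pow_ideal0.
- have [|s sE] := expd_sub _ _ t n 1 L t DI n_gt0; first by exists 1; rewrite mulr1.
  (* exp(D) t - t = t^2 s, so s itself serves as epsilon. *)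
  by exists s; rewrite -[LHS](subrK t) sE; ring.
Qed.

Lemma chi_inj : set_inj (Der0 A n) (@chi k A n).
Proof.
move=> D D' /set_mem/Der0P[Dlin _ DI] /set_mem/Der0P[D'lin _ D'I] DD'.
have [L LE] := linear_pack _ _ _ Dlin; have [L' LE'] := linear_pack _ _ _ D'lin.
subst D D'; apply/funext; apply: (expd_inj _ _ pchar0 t n tn0) => // r.
by rewrite -!chi_expd// DD'.
Qed.

Lemma chi_surj : set_surj (Der0 A n) (Aut0 A n) (@chi k A n).
Proof.
move=> g [[glin gM] _ g1 gt].
have [G GE] : exists G : {lrmorphism Rn -> Rn}, G = g :> (Rn -> Rn).
  pose gL := GRing.isLinear.Build k Rn Rn *:%R g glin.
  pose gR := GRing.isMonoidMorphism.Build Rn Rn g gM.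
  by exists (HB.pack g gL gR : {lrmorphism Rn -> Rn}).
subst g.
pose N : {linear Rn -> Rn} := G \- idfun.
have NE r : N r = G r - r by [].
have NI : raises t N by apply: (morph_sub1_raises _ _ t G); rewrite ?expr1.
have LI : raises t (logd n N) by exact: logd_raises.
exists (logd n N).
  apply/Der0P; split=> //.
    exact: (logd_linear _ _ pchar0 t n tn0 G).
  exact: (logd_leibniz _ _ pchar0 t n tn0 G).
by apply/funext => r; rewrite chi_expd// (expd_logd _ _ pchar0 t n tn0 G).
Qed.

End TruncatedPolynomials.

Theorem theorem6p1p5 (R : realType) (A : comAlgType R[i]) (d : nat)
    (hd : (0 < d)%N) (hA : smooth_affine_variety A d)
    (Omega : lmodType A) (dA : A -> Omega)
    (hOmega : is_kaehler_differentials dA)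
    (x : 'I_d -> A) (hx : is_free_basis (fun i => dA (x i)))
    (n : nat) (hn : (2 <= n)%N) :
  set_bij (Der0 A n) (Aut0 A n) (@chi _ A n).
Proof.
have pchar0 := Num.Theory.pchar_num R[i].
split; [exact: chi_Aut0 | exact: chi_inj | exact: chi_surj].
Qed.
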